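(* Let $\mathcal{I}=\{I_n\}_{n\in\mathbb{N}_0}$ be a sequence of ranking indices $I_n:\operatorname{FN}(\mathbb{R})\to\mathbb{R}$ that are increasing on the $\alpha$-cuts, i.e. $A\le_{KY}B$ implies $I_n(A)\le I_n(B)$ for all $A,B\in\operatorname{FN}(\mathbb{R})$ and $n\in\mathbb{N}_0$. Let $\mathcal{S}\subseteq\operatorname{FN}(\mathbb{R})$ be a subfamily such that $\mathcal{I}$ is separating on $\mathcal{S}$. Then the sequential binary relation $\le_{\Phi_{\mathcal{I}}}$, where $\Phi_{\mathcal{I}}(A)=\{I_n(A)\}_{n\in\mathbb{N}_0}\in\operatorname{seq}(\mathbb{R})$, is an admissible total order on $\mathcal{S}$; that is, it is a total order on $\mathcal{S}$ and $A\le_{KY}B$ implies $A\le_{\Phi_{\mathcal{I}}}B$ for all $A,B\in\mathcal{S}$.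
   Context: A fuzzy set on $\mathbb{R}$ is a map $A:\mathbb{R}\to[0,1]$; for $\alpha\in(0,1]$, $A_\alpha=\{x:A(x)\ge\alpha\}$, and $A_0$ is the closure of the support $\bigcup_{\alpha\in(0,1]}A_\alpha$. $A$ is a fuzzy number if $A_1\ne\emptyset$, $A_0$ is bounded, and $A_\alpha=[\underline{A}_\alpha,\overline{A}_\alpha]$ is a closed interval for each $\alpha\in(0,1]$ (same endpoint notation for $\alpha=0$); $\operatorname{FN}(\mathbb{R})$ is the set of fuzzy numbers. The Klir–Yuan partial order is: $A\le_{KY}B$ iff $\underline{A}_\alpha\le\underline{B}_\alpha$ and $\overline{A}_\alpha\le\overline{B}_\alpha$ for all $\alpha\in[0,1]$. A ranking index is a mapping $\operatorname{FN}(\mathbb{R})\to\mathbb{R}$. A countable family $\{I_n\}_{n\in\mathbb{N}_0}$ of ranking indices is separating on $\mathcal{S}$ if for any two distinct $A,B\in\mathcal{S}$ there is $k\in\mathbb{N}_0$ with $I_k(A)\ne I_k(B)$. $\operatorname{seq}(\mathbb{R})=\mathbb{R}^{\mathbb{N}_0}$ with $\mathbb{N}_0=\{0,1,2,\dots\}$, and $\mathfrak a\sqsubseteq\mathfrak b$ means that either $\mathfrak a=\mathfrak b$, or there is $n_0\in\mathbb{N}_0$ with $a_n=b_n$ for all $n<n_0$ and $a_{n_0}<b_{n_0}$. The sequential relation is $A\le_{\Phi_{\mathcal{I}}}B\iff\Phi_{\mathcal{I}}(A)\sqsubseteq\Phi_{\mathcal{I}}(B)$. *)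

(* Defs.v *)
From HB Require Import structures.
From mathcomp Require Import all_boot all_order all_algebra.
From mathcomp Require Import all_classical all_reals all_analysis.

Set Implicit Arguments.
Unset Strict Implicit.
Unset Printing Implicit Defensive.

Import Order.TTheory GRing.Theory Num.Theory.
Import numFieldNormedType.Exports.

Local Open Scope classical_set_scope.
Local Open Scope ring_scope.

Definition fuzzy_set (R : realType) (A : R -> R) : Prop :=
  forall x, 0 <= A x <= 1.

Definition pos_cut (R : realType) (A : R -> R) (a : R) : set R :=
  [set x | a <= A x].

Definition fuzzy_support (R : realType) (A : R -> R) : set R :=
  \bigcup_(a in `]0, 1]) pos_cut A a.

(* [set x | 0 <= A x] would be the whole line, hence the special case. *)
Definition cut (R : realType) (A : R -> R) (a : R) : set R :=
  if a == 0 then closure (fuzzy_support A) else pos_cut A a.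

Record fuzzy_number (R : realType) := FuzzyNumber {
  membership :> R -> R;
  membership_fuzzy : fuzzy_set membership;
  cut1_nonempty : cut membership 1 !=set0;
  cut0_bounded : bounded_set (cut membership 0);
  cut_closed_interval : forall a, a \in `]0, 1] ->
    exists l u : R, cut membership a = [set` `[l, u]] }.

(* Endpoints of the cuts; [cut_itv] below shows that [cut A a] is the closed
   interval they delimit, for every [a] in [0, 1]. *)
Definition lower (R : realType) (A : fuzzy_number R) (a : R) : R :=
  inf (cut A a).
Definition upper (R : realType) (A : fuzzy_number R) (a : R) : R :=
  sup (cut A a).

Definition le_KY (R : realType) (A B : fuzzy_number R) : Prop :=
  forall a, a \in `[0, 1] -> lower A a <= lower B a /\ upper A a <= upper B a.

Definition ranking_index (R : realType) := fuzzy_number R -> R.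

Definition increasing_on_cuts (R : realType) (I : ranking_index R) : Prop :=
  forall A B : fuzzy_number R, le_KY A B -> I A <= I B.

Definition separating (R : realType) (I : nat -> ranking_index R)
    (S : set (fuzzy_number R)) : Prop :=
  forall A B, S A -> S B -> A <> B -> exists k, I k A <> I k B.

Definition seq_lex (R : realType) (a b : nat -> R) : Prop :=
  a = b \/
  exists n0, (forall n, (n < n0)%N -> a n = b n) /\ a n0 < b n0.

Definition index_seq (R : realType) (I : nat -> ranking_index R)
    (A : fuzzy_number R) : nat -> R :=
  fun n => I n A.

Definition le_seq (R : realType) (I : nat -> ranking_index R)
    (A B : fuzzy_number R) : Prop :=
  seq_lex (index_seq I A) (index_seq I B).

Definition total_order_on (T : Type) (S : set T) (r : T -> T -> Prop) : Prop :=
  [/\ forall x, S x -> r x x,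
      forall x y, S x -> S y -> r x y -> r y x -> x = y,
      forall x y z, S x -> S y -> S z -> r x y -> r y z -> r x z
    & total_on S r].

Definition admissible_total_order_on (R : realType) (S : set (fuzzy_number R))
    (r : fuzzy_number R -> fuzzy_number R -> Prop) : Prop :=
  total_order_on S r /\ forall A B, S A -> S B -> le_KY A B -> r A B.

Lemma fuzzy_number_eq (R : realType) (A B : fuzzy_number R) :
  membership A = membership B -> A = B.
Proof.
case: A B => [a a1 a2 a3 a4] [b b1 b2 b3 b4] /= E; subst b.
by congr FuzzyNumber; exact: Prop_irrelevance.
Qed.

Lemma cut_itv (R : realType) (A : fuzzy_number R) (a : R) :
  a \in `[0, 1] -> cut A a = [set` `[lower A a, upper A a]].
Proof.
rewrite in_itv/= => /andP[a0 a1].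
have [x1 x1A] : pos_cut A 1 !=set0.
  by have := cut1_nonempty A; rewrite /cut oner_eq0.
have [{a0 a1}-> | an0] := eqVneq a 0; last first.
  have ai : a \in `]0, 1] by rewrite in_itv/= lt_neqAle eq_sym an0 a0 a1.
  have [l [u e]] := cut_closed_interval A ai.
  have lu : l <= u.
    have : cut A a x1 by rewrite /cut (negPf an0); exact: le_trans x1A.
    by rewrite e /= in_itv /= => /andP[]; exact: le_trans.
  by rewrite /lower /upper e inf_itv ?sup_itv // bnd_simp.
have cut0E : cut A 0 = closure (fuzzy_support A) by rewrite /cut eqxx.
have suppi : is_interval (fuzzy_support A).
  move=> x y [b /= bi xb] [c /= ci yc] z xzy.
  pose d := Num.min b c.
  have di : d \in `]0, 1].
    move: bi ci; rewrite !in_itv /= => /andP[b0 b1] /andP[c0 c1].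
    by rewrite lt_min b0 c0 ge_min b1.
  exists d => //.
  have dn0 : d != 0 by move: di; rewrite in_itv /= => /andP[/lt0r_neq0].
  have [l [u]] := cut_closed_interval A di.
  rewrite /cut (negPf dn0) => e.
  have : pos_cut A d x by apply: le_trans xb; rewrite ge_min lexx.
  have : pos_cut A d y by apply: le_trans yc; rewrite ge_min lexx orbT.
  rewrite e /= !in_itv /= => /andP[ly yu] /andP[lx xu].
  by case/andP: xzy => xz zy; rewrite (le_trans lx xz) (le_trans zy yu).
have ci : is_interval (cut A 0).
  rewrite cut0E; apply/connected_intervalP/connected_closure.
  exact/connected_intervalP.
have cc : closed (cut A 0) by rewrite cut0E; exact: closed_closure.
have ne : cut A 0 !=set0.
  exists x1; rewrite cut0E; apply: subset_closure; exists 1 => //=.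
  by rewrite in_itv /= ltr01 lexx.
have [M M0 bM] := ex_strict_bound_gt0 (cut0_bounded A).
have cpt : compact (cut A 0).
  apply: (subclosed_compact cc (@segment_compact R (- M) M)) => x /bM /ltW.
  by rewrite ler_norml /= in_itv.
have cont : {within cut A 0, continuous (fun x : R => x)}.
  by apply: continuous_subspaceT => x; exact: cvg_id.
have [u + umax] := compact_EVT_max ne cpt cont.
have [l + lmin] := compact_EVT_min ne cpt cont.
rewrite !inE => lA uA.
have e : cut A 0 = [set` `[l, u]].
  apply/seteqP; split=> x /=; rewrite in_itv /=.
    by move=> xA; rewrite lmin ?umax ?inE.
  exact: (ci l u).
have lu : l <= u by apply: lmin; rewrite inE.
by rewrite /lower /upper e inf_itv ?sup_itv // bnd_simp.
Qed.

(* Main.v *)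
Require Import Defs.
From mathcomp Require Import all_boot all_order all_algebra.
From mathcomp Require Import all_classical all_reals all_analysis.

Set Implicit Arguments.
Unset Strict Implicit.
Unset Printing Implicit Defensive.

Import Order.TTheory.

(** Two distinct real sequences have a first index where they differ, and the reals are totally
    ordered there; hence [seq_lex] is a total order on sequences. [le_seq I] is its pullback along
    [index_seq I]: reflexivity, transitivity and totality survive any pullback, while antisymmetry
    needs injectivity on [S], which is what [separating] provides. Monotone indices turn [le_KY]
    into a pointwise inequality of sequences, and [seq_lex_pointwise] makes that lexicographic. *)

Section SeqLex.
Variable R : realType.
Implicit Types a b c : nat -> R.

Lemma first_difference a b : a <> b ->
  exists n0, (forall n, (n < n0)%N -> a n = b n) /\ a n0 != b n0.
Proof.
move=> ab; have ex : exists n, a n != b n.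
  apply: contra_notP ab => nex; apply/funext => n.
  by apply: contra_notP nex => /eqP abn; exists n.
case: (ex_minnP ex) => n0 abn0 minn0; exists n0; split=> // n nn0.
by apply/eqP; apply: contraTT nn0 => /minn0; rewrite -leqNgt.
Qed.

Lemma seq_lex_total a b : seq_lex a b \/ seq_lex b a.
Proof.
have [->|/first_difference[n0 [abn]]] := pselect (a = b); first by left; left.
rewrite neq_lt => /orP[abn0|ban0]; first by left; right; exists n0.
by right; right; exists n0; split=> // n /abn.
Qed.

(** At the first difference, the weak inequality becomes strict. *)
Lemma seq_lex_pointwise a b : (forall n, a n <= b n)%R -> seq_lex a b.
Proof.
move=> leab; have [->|/first_difference[n0 [abn nab]]] := pselect (a = b).
  by left.
by right; exists n0; split=> //; rewrite lt_neqAle nab leab.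
Qed.

Lemma seq_lex_anti a b : seq_lex a b -> seq_lex b a -> a = b.
Proof.
case=> // -[m [abm ltm]] [//|[n [ban ltn]]].
(* At the smaller witness, one hypothesis gives equality and the other a strict inequality; if the
   witnesses coincide, the two strict inequalities clash. *)
case: (ltngtP m n) => [/ban bam|/abm abn|mn].
- by rewrite bam ltxx in ltm.
- by rewrite abn ltxx in ltn.
- by move: ltn; rewrite -mn => /(lt_trans ltm); rewrite ltxx.
Qed.

Lemma seq_lex_trans a b c : seq_lex a b -> seq_lex b c -> seq_lex a c.
Proof.
case=> [->//|[m [abm ltm]]] [<-|[n [bcn ltn]]]; right; first by exists m.
(* Below both witnesses the three sequences agree; at the smaller one, one step is strict and the
   other is an equality, or both are strict when [m = n]. *)
exists (minn m n); split=> [k|].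
  by rewrite leq_min => /andP[/abm-> /bcn].
case: (ltngtP m n) => [/bcn <- //|/abm -> //|mn].
by rewrite (lt_trans ltm)// mn.
Qed.

End SeqLex.

Theorem theorem6p5 (R : realType) (I : nat -> ranking_index R)
    (S : set (fuzzy_number R)) :
  (forall n, increasing_on_cuts (I n)) ->
  separating I S ->
  admissible_total_order_on S (le_seq I).
Proof.
move=> incI sepI; split; last first.
  by move=> A B _ _ AB; apply: seq_lex_pointwise => n; exact: incI.
split=> [A _|A B SA SB AB BA|A B C _ _ _|A B _ _].
- by left.
- apply: contrapT => /(sepI _ _ SA SB)[k]; apply.
  by have /(congr1 (@^~ k)) := seq_lex_anti AB BA.
- exact: seq_lex_trans.
- exact: seq_lex_total.
Qed.
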